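(* For all natural numbers $r, n, \delta \geq 2$, there exists a $d$-regular graph $G = G(r,n,\delta)$ with $d > \delta$, $\chi(G) = n$ and $\chi_r(G) = r\,\chi(G)$.
   Context: All graphs are finite and simple. A proper $k$-colouring of a graph $G$ is a map $c\colon V(G)\to[k]$ with $c(u)\neq c(v)$ for every edge $uv$; $\chi(G)$ is the chromatic number. For an integer $r\ge 1$, an $r$-dynamic $k$-colouring of $G$ is a proper $k$-colouring $c$ such that for every vertex $v$, the set $c(N(v))$ of colours used on the neighbourhood $N(v)$ has size at least $\min\{r, d(v)\}$, where $d(v)$ is the degree of $v$. The $r$-dynamic chromatic number $\chi_r(G)$ is the least $k$ such that $G$ has an $r$-dynamic $k$-colouring. *)

(* Defs.v *)
From mathcomp Require Import all_boot.
Set Implicit Arguments. Unset Strict Implicit. Unset Printing Implicit Defensive.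

Definition simple_graph (T : finType) (e : rel T) : Prop :=
  symmetric e /\ irreflexive e.

Definition nbhd (T : finType) (e : rel T) (v : T) : {set T} := [set u | e v u].
Definition deg (T : finType) (e : rel T) (v : T) : nat := #|nbhd e v|.

Definition regular (T : finType) (e : rel T) (d : nat) : Prop :=
  forall v : T, deg e v = d.

Definition proper_col (T : finType) (e : rel T) (k : nat) (c : T -> 'I_k) : Prop :=
  forall u v : T, e u v -> c u != c v.

Definition r_dynamic_col (T : finType) (e : rel T) (r k : nat) (c : T -> 'I_k) : Prop :=
  proper_col e c /\ forall v : T, minn r (deg e v) <= #|c @: nbhd e v|.

Definition chromatic_number (T : finType) (e : rel T) (m : nat) : Prop :=
  (exists c : T -> 'I_m, proper_col e c) /\
  forall k, (exists c : T -> 'I_k, proper_col e c) -> m <= k.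

Definition r_dynamic_chromatic_number (T : finType) (e : rel T) (r m : nat) : Prop :=
  (exists c : T -> 'I_m, r_dynamic_col e r c) /\
  forall k, (exists c : T -> 'I_k, r_dynamic_col e r c) -> m <= k.

(* Main.v *)
(** Fix [M] clusters, each a complete [n]-partite graph with parts of size [s].
    For every part index [i] and every set [Q] of [n] clusters, a hub [(i, Q)]
    is joined to the [i]-th parts of the clusters in [Q].  A hub has degree
    [n * s] and a cluster vertex has degree [(n - 1) * s + 'C(M - 1, n - 1)], so
    [s = 'C(M - 1, n - 1)] makes the graph regular.  The parts of one cluster
    receive disjoint sets of colours, so with fewer than [r * n] colours every
    cluster has a part showing fewer than [r] colours.  If [M] is large, [n]
    clusters agree on the index and on the colour set of such a part, and the
    hub over them sees fewer than [r] colours. *)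
Require Import Defs.
From mathcomp Require Import all_boot.

Set Implicit Arguments.
Unset Strict Implicit.
Unset Printing Implicit Defensive.

(** Pascal's rule and induction: the second summand is positive, so each step gains at least one.
    This is what lets the part size be made arbitrarily large. *)
Lemma leq_bin_self m k : 0 < k < m -> m <= 'C(m, k).
Proof.
elim: m k => [|m IHm] [|k] //=; rewrite ltnS => lt_km.
rewrite binS; move: lt_km; rewrite leq_eqVlt => /predU1P[<-|lt_km].
  by rewrite binn binSn.
by rewrite -addn1 leq_add ?IHm ?bin_gt0 // ltnW // ltnW.
Qed.

(** Adding [a] is a bijection from the [k]-subsets avoiding [a]. With [T] the clusters, this counts
    the hubs at a cluster vertex. *)
Lemma card_draws_mem (T : finType) (a : T) k :
  #|[set Q : {set T} | (#|Q| == k.+1) && (a \in Q)]| = 'C(#|T|.-1, k).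
Proof.
have -> : [set Q : {set T} | (#|Q| == k.+1) && (a \in Q)] =
    (fun B => a |: B) @: [set B : {set T} | B \subset [set~ a] & #|B| == k].
  apply/setP=> Q; rewrite inE; apply/andP/imsetP => [[cQ aQ]|[B + ->]].
    exists (Q :\ a); last by rewrite setD1K.
    rewrite inE -eqSS -add1n -[1]/(true : nat) -aQ -cardsD1 cQ andbT.
    by apply/subsetP=> x; rewrite !inE => /andP[].
  rewrite inE => /andP[/subsetP sB /eqP <-].
  have aNB : a \notin B by apply/negP => /sB; rewrite !inE eqxx.
  by rewrite cardsU1 aNB setU11.
rewrite card_in_imset => [|B C]; first by rewrite cards_draws cardsC1.
rewrite !inE => /andP[/subsetP sB _] /andP[/subsetP sC _] eqBC.
have aN (D : {set T}) : {subset D <= [set~ a]} -> a \notin D.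
  by move=> sD; apply/negP => /sD; rewrite !inE eqxx.
by rewrite -(setU1K (aN _ sB)) eqBC setU1K ?aN.
Qed.

Lemma pigeonhole_fiber (A X : finType) (f : A -> X) m :
  m * #|X| < #|A| -> exists x, m < #|[set a | f a == x]|.
Proof.
move=> ltA; apply/existsP; apply: contraLR ltA => /existsPn small.
rewrite -leqNgt -sum1_card (partition_big f xpredT) //= mulnC -sum_nat_const.
by apply: leq_sum => x _; rewrite sum1dep_card leqNgt small.
Qed.

Lemma subset_of_card (T : finType) (A : {set T}) m :
  m <= #|A| -> exists2 B : {set T}, B \subset A & #|B| = m.
Proof.
move=> /card_geqP[s [us <- sA]]; exists [set x in s].
  by apply/subsetP=> x; rewrite inE => /sA.
by rewrite cardsE; apply/card_uniqP.
Qed.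

(** Renaming colours injectively preserves both conditions, so colours may be taken in any finite
    type, such as pairs. *)
Lemma r_dynamic_col_fin (T C : finType) (e : rel T) r (c : T -> C) :
  (forall u v, e u v -> c u != c v) ->
  (forall v, minn r (deg e v) <= #|c @: nbhd e v|) ->
  exists c' : T -> 'I_#|C|, r_dynamic_col e r c'.
Proof.
move=> c_proper c_dyn; exists (enum_rank \o c); split.
  by move=> u v /c_proper; rewrite /= (inj_eq enum_rank_inj).
move=> v; rewrite imset_comp card_imset //; exact: enum_rank_inj.
Qed.

Section HubGraph.

Variables (M n s : nat).

(** An element is a set of [n] clusters, the second coordinate of a hub; single clusters are indexed
    by ['I_M]. *)
Definition clusters : finType := {Q : {set 'I_M} | #|Q| == n}.

(** [inl (a, i, j)] is the [j]-th vertex of part [i] in cluster [a]; [inr (i, Q)] is a hub. *)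
Definition hub_vertex : finType :=
  (('I_M * 'I_n * 'I_s) + ('I_n * clusters))%type.

Definition hub_edge : rel hub_vertex := fun u v =>
  match u, v with
  | inl x, inl y => (x.1.1 == y.1.1) && (x.1.2 != y.1.2)
  | inl x, inr w => (x.1.2 == w.1) && (x.1.1 \in val w.2)
  | inr w, inl x => (x.1.2 == w.1) && (x.1.1 \in val w.2)
  | inr _, inr _ => false
  end.

Lemma hub_simple : simple_graph hub_edge.
Proof.
split=> [[x|w] [y|w']|[x|w]] //=; last by rewrite !eqxx.
by rewrite eq_sym (eq_sym x.1.2).
Qed.

Lemma deg_hub_edge v :
  deg hub_edge v = #|[set x | hub_edge v (inl x)]| + #|[set w | hub_edge v (inr w)]|.
Proof.
rewrite /deg /nbhd cardsE -sum1_card big_sumType /=.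
by congr (_ + _); rewrite -sum1dep_card.
Qed.

Lemma hub_regular : 0 < n -> s = 'C(M.-1, n.-1) -> regular hub_edge (n * s).
Proof.
move=> n_gt0 def_s [[[a i] j]|[i Q]]; rewrite deg_hub_edge /=.
  have -> : [set x : 'I_M * 'I_n * 'I_s | (a == x.1.1) && (i != x.1.2)] =
      setX (setX [set a] [set~ i]) setT.
    by apply/setP=> -[[b i'] j']; rewrite !inE /= andbT eq_sym (eq_sym i).
  have -> : [set w : 'I_n * clusters |
      (i == w.1) && (a \in val w.2)] = setX [set i] [set Q : clusters | a \in val Q].
    by apply/setP=> -[i' Q]; rewrite !inE /= eq_sym.
  have card_star : #|[set Q : clusters | a \in val Q]| = s.
    rewrite def_s -[M in RHS]card_ord -(card_draws_mem a) prednK //.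
    rewrite -(card_imset _ val_inj); apply: eq_card => Q.
    rewrite !inE; apply/imsetP/andP => [[P + ->]|[cQ aQ]].
      by rewrite inE (valP P).
    by exists (Sub Q cQ); rewrite ?inE SubK.
  rewrite !cardsX !cards1 cardsC1 cardsT !card_ord card_star !mul1n.
  by rewrite addnC -mulSn prednK.
have -> : [set x : 'I_M * 'I_n * 'I_s | (x.1.2 == i) && (x.1.1 \in val Q)] =
    setX (setX (val Q) [set i]) setT.
  by apply/setP=> -[[b i'] j']; rewrite !inE /= andbT andbC.
rewrite !cardsX cards1 cardsT card_ord (eqP (valP Q)) muln1.
by rewrite (_ : [set _ | _] = set0) ?cards0 ?addn0 //; apply/setP=> w; rewrite !inE.
Qed.

(** A hub of index [i] sees only [i]-th parts, so it can take the colour of any other part; the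
    cyclic successor is one choice. *)
Definition other_part (i : 'I_n) : 'I_n := ordS i.

Lemma other_part_neq i : 1 < n -> other_part i != i.
Proof.
move=> n_gt1; apply/eqP => /(congr1 val) /=.
have := ltn_ord i; rewrite leq_eqVlt => /predU1P[def_n|lt_in].
  by rewrite def_n modnn => i0; move: n_gt1; rewrite -def_n -i0.
by rewrite modn_small // => /eqP; rewrite gtn_eqF.
Qed.

Definition part_of (v : hub_vertex) : 'I_n :=
  match v with inl x => x.1.2 | inr w => other_part w.1 end.

Lemma part_of_proper u v : 1 < n -> hub_edge u v -> part_of u != part_of v.
Proof.
move=> n_gt1; case: u v => [x|w] [y|w'] //= /andP[] => [_ //||].
  by move=> /eqP-> _; rewrite eq_sym other_part_neq.
by move=> /eqP-> _; rewrite other_part_neq.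
Qed.

Lemma hub_chromatic : 0 < M -> 1 < n -> 0 < s -> chromatic_number hub_edge n.
Proof.
move=> M_gt0 n_gt1 s_gt0; split.
  by exists part_of => u v; apply: part_of_proper.
move=> k [c c_proper]; rewrite -(card_ord n) -(card_ord k).
pose a0 := Ordinal M_gt0; pose j0 := Ordinal s_gt0.
(* One vertex from each part of a single cluster gives a clique of size [n]. *)
apply: (@leq_card _ _ (fun i : 'I_n => c (inl (a0, i, j0)))) => i i' /eqP.
by apply: contraTeq => neq_i; apply: c_proper; apply/andP.
Qed.

(** A colour is a part index paired with one of [r] shades. Every neighbourhood contains a whole
    part, and that part shows all [r] shades. *)
Lemma hub_r_dynamic_col r : 0 < r <= s -> 1 < n ->
  exists c : hub_vertex -> 'I_(r * n), r_dynamic_col hub_edge r c.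
Proof.
case: r => // r lt_rs n_gt1.
have -> : r.+1 * n = #|{: 'I_r.+1 * 'I_n}| by rewrite card_prod !card_ord.
(* The first [r.+1] positions of a part get distinct shades; [inord] sends any later position to the
   default [ord0], which is harmless. *)
pose shade (v : hub_vertex) : 'I_r.+1 :=
  match v with inl x => inord x.2 | inr _ => ord0 end.
apply: (@r_dynamic_col_fin _ _ _ _ (fun v => (shade v, part_of v))) => [u v euv|v].
  by apply: contraNneq (part_of_proper n_gt1 euv) => -[_ ->].
have [a [i nbr]] : exists a i, forall j, hub_edge v (inl (a, i, j)).
  case: v => [[[a i] j]|[i Q]].
    by exists a, (other_part i) => j'; rewrite /= eqxx eq_sym other_part_neq.
  have /card_gt0P[a aQ] : 0 < #|val Q| by rewrite (eqP (valP Q)) ltnW.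
  by exists a, i => j; rewrite /= eqxx.
apply: leq_trans (geq_minl _ _) _.
rewrite -[r.+1 in leqLHS]card_ord -[leqLHS](@card_imset _ _ (fun t => (t, i))) => [|t t' []//].
apply/subset_leq_card/subsetP => _ /imsetP[t _ ->].
apply/imsetP; exists (inl (a, i, widen_ord lt_rs t)); first by rewrite inE.
by rewrite /= inord_val.
Qed.

Lemma hub_r_dynamic_lower r k (c : hub_vertex -> 'I_k) :
  0 < n -> r <= n * s -> s = 'C(M.-1, n.-1) -> n.-1 * (n * 2 ^ k) < M ->
  r_dynamic_col hub_edge r c -> r * n <= k.
Proof.
move=> n_gt0 le_rd def_s ltM [c_proper c_dyn]; rewrite leqNgt; apply/negP => lt_k.
pose pal a i := [set c (inl (a, i, j)) | j : 'I_s].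
have [f f_poor] : exists f, forall a, #|pal a (f a)| < r.
  apply: (@fin_all_exists _ _ (fun a i => #|pal a i| < r)) => a.
  apply/existsP; apply: contraLR lt_k => /existsPn rich.
  have disj i i' : i != i' -> [disjoint pal a i & pal a i'].
    move=> neq_i; apply/pred0P => x /=; apply/negP => /andP[].
    move=> /imsetP[j _ ->] /imsetP[j' _] /eqP; apply/negP.
    by apply: c_proper; rewrite /= eqxx.
  rewrite -leqNgt -[k in leqRHS]card_ord -cardsT.
  apply: leq_trans (subset_leq_card (subsetT (\bigcup_i pal a i))).
  rewrite -sum1_card partition_disjoint_bigcup //= mulnC -[n in leqLHS]card_ord.
  rewrite -sum_nat_const; apply: leq_sum => i _.
  by rewrite sum1_card leqNgt rich.
(* There are [n * 2 ^ k] pairs of a part index and a colour set, so some pair is shared by at least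
   [n] clusters. *)
have [[i C]] : exists x, n.-1 < #|[set a | (f a, pal a (f a)) == x]|.
  apply: pigeonhole_fiber.
  by rewrite card_prod card_ord -cardsT -powersetT card_powerset cardsT !card_ord.
rewrite prednK // => /subset_of_card[Q /subsetP sQ /eqP cQ].
have Q_poor a : a \in Q -> pal a i = C /\ #|C| < r.
  by move=> /sQ; rewrite inE => /eqP[<- <-]; split.
have [a aQ] : exists a, a \in Q by apply/card_gt0P; rewrite (eqP cQ).
have [_] := Q_poor a aQ; apply/negP; rewrite -leqNgt.
have := c_dyn (inr (i, Sub Q cQ)); rewrite hub_regular // (minn_idPl le_rd).
move/leq_trans; apply; apply/subset_leq_card/subsetP => _ /imsetP[[[[b i'] j]|w] + ->];
  rewrite inE //= => /andP[/eqP-> bQ].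
have [<- _] := Q_poor b bQ; exact: imset_f.
Qed.

End HubGraph.

Theorem theorem1p3 : forall r n delta : nat, 2 <= r -> 2 <= n -> 2 <= delta ->
  exists (T : finType) (e : rel T) (d : nat),
    [/\ simple_graph e, regular e d, delta < d,
        chromatic_number e n & r_dynamic_chromatic_number e r (r * n)].
Proof.
move=> r n delta r_gt1 n_gt1 delta_gt1.
have n_gt0 : 0 < n by apply: ltnW.
(* There will be [m.+1] clusters. The summand [n] gives [n.-1 < m], hence [m <= s]; then [r] and
   [delta.+1] bound [s] from below, and the last summand feeds the pigeonhole. *)
pose m := r + delta.+1 + n + n.-1 * (n * 2 ^ (r * n)).
pose s := 'C(m.+1.-1, n.-1).
have le_ms : m <= s.
  apply: leq_bin_self; rewrite -subn1 subn_gt0 n_gt1 /= subn1 prednK //.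
  by rewrite /m -addnA addnCA leq_addr.
have le_rs : r <= s by apply: leq_trans le_ms; rewrite /m -!addnA leq_addr.
have lt_ds : delta < s.
  by apply: leq_trans le_ms; rewrite /m -!addnA addnCA leq_addr.
have le_sd : s <= n * s by rewrite leq_pmull.
exists (hub_vertex m.+1 n s), (@hub_edge m.+1 n s), (n * s); split.
- exact: hub_simple.
- exact: hub_regular.
- exact: leq_trans le_sd.
- by apply: hub_chromatic => //; apply: leq_ltn_trans lt_ds.
split; first by apply: hub_r_dynamic_col; rewrite // le_rs ltnW.
(* [m] was chosen for [r * n] colours; for fewer colours the pigeonhole requirement is only
   weaker. *)
move=> k [c c_dyn]; case: (boolP (k < r * n)) => [lt_k|]; last by rewrite -leqNgt.
apply: hub_r_dynamic_lower c_dyn => //; first exact: leq_trans le_sd.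
rewrite ltnS; apply: leq_trans (leq_addl _ _).
by rewrite !leq_mul2l leq_exp2l // (ltnW lt_k) !orbT.
Qed.
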